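(* Let $F_2$ be a free group on two generators. Then the natural action of the automorphism group $\mathrm{Aut}(F_2)$ on the space $\mathcal{BO}(F_2)$ of bi-orders of $F_2$ has no dense orbits.
   Context: A bi-order on a group $G$ is a (strict) total order $<$ on $G$ that is invariant under left and right multiplication. Its positive cone is $P_<=\{g\in G: g>1\}$. The set $\mathcal{BO}(G)$ of all bi-orders on $G$ carries the topology whose base consists of the sets $U_S=\{<\,\in\mathcal{BO}(G) : S\subset P_<\}$, for finite $S\subset G$. An automorphism $\sigma\in\mathrm{Aut}(G)$ acts on $\mathcal{BO}(G)$ by sending $<$ to the bi-order $\sigma(<)$ with positive cone $\sigma(P_<)$. *)

(* Defs.v *)
From HB Require Import structures.
From mathcomp Require Import all_boot.
From mathcomp Require Import boolp classical_sets functions cardinality.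
From mathcomp Require Import topology.

Set Implicit Arguments.
Unset Strict Implicit.
Unset Printing Implicit Defensive.

Local Open Scope group_scope.
Local Open Scope classical_set_scope.

(* [groupType] covers infinite groups. The library bundles group homomorphisms
   as maps preserving both the product and the unit. *)
Notation "{ 'grouphom' G -> H }" := (UMagmaMorphism.type G H)
  (G at level 98, H at level 99) : type_scope.

(* F is free on the pair (a, b): the universal property. *)
Definition free_on2 (F : groupType) (a b : F) : Prop :=
  forall (H : groupType) (x y : H),
    exists f : {grouphom F -> H},
      [/\ f a = x, f b = y &
          forall g : {grouphom F -> H}, g a = x -> g b = y -> g =1 f].

Record biorder (G : groupType) := Biorder {
  blt :> G -> G -> Prop;
  blt_irr : forall x, ~ blt x x;
  blt_trans : forall x y z, blt x y -> blt y z -> blt x z;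
  blt_total : forall x y, x <> y -> blt x y \/ blt y x;
  blt_mull : forall z x y, blt x y -> blt (z * x) (z * y);
  blt_mulr : forall z x y, blt x y -> blt (x * z) (y * z) }.

Definition poscone (G : groupType) (o : biorder G) : set G := [set g | o 1 g].

Section Topology.
Variable G : groupType.

HB.instance Definition _ := gen_eqMixin (biorder G).
HB.instance Definition _ := gen_choiceMixin (biorder G).

Definition biorder_base (S : set G) : set (biorder G) :=
  [set o | S `<=` poscone o].

Lemma biorder_base_cover :
  \bigcup_(S in [set S : set G | finite_set S]) biorder_base S = setT.
Proof.
by apply/seteqP; split=> // o _; exists set0 => //=; exact: finite_set0.
Qed.

Lemma biorder_base_join (S1 S2 : set G) (o : biorder G) :
  finite_set S1 -> finite_set S2 ->
  biorder_base S1 o -> biorder_base S2 o ->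
  exists S, [/\ finite_set S, biorder_base S o &
    biorder_base S `<=` biorder_base S1 `&` biorder_base S2].
Proof.
move=> f1 f2 o1 o2; exists (S1 `|` S2); split.
- by rewrite finite_setU.
- by move=> x [/o1|/o2].
- by move=> o' h; split=> x ?; apply: h; [left|right].
Qed.

HB.instance Definition _ := @isBaseTopological.Build (biorder G)
  (set G) [set S | finite_set S] biorder_base
  biorder_base_cover biorder_base_join.

End Topology.

Record aut (G : groupType) := Aut {
  aut_fun :> {grouphom G -> G};
  aut_bij : bijective aut_fun }.

Section Action.
Variables (G : groupType) (s : aut G) (o : biorder G).

Definition act_lt (x y : G) : Prop := (s @` poscone o) (x^-1 * y).

Lemma act_ltE x y : act_lt (s x) (s y) <-> o x y.
Proof.
split=> [[g og]|oxy].
  rewrite -gmulfV -gmulfM => /(bij_inj (aut_bij s)) eg.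
  by have := blt_mull x og; rewrite eg mulg1 mulVKg.
exists (x^-1 * y); last by rewrite gmulfM gmulfV.
by rewrite /poscone /= -(mulVg x); apply: blt_mull.
Qed.

Lemma aut_surj x : exists u, x = s u.
Proof. by case: (aut_bij s) => t _ ts; exists (t x); rewrite ts. Qed.

Lemma act_irr x : ~ act_lt x x.
Proof.
by have [u ->] := aut_surj x; rewrite act_ltE; exact: blt_irr.
Qed.

Lemma act_trans x y z : act_lt x y -> act_lt y z -> act_lt x z.
Proof.
have [[[u ->] [v ->]] [w ->]] := (aut_surj x, aut_surj y, aut_surj z).
by rewrite !act_ltE; exact: blt_trans.
Qed.

Lemma act_total x y : x <> y -> act_lt x y \/ act_lt y x.
Proof.
have [[u ->] [v ->]] := (aut_surj x, aut_surj y) => ne.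
by rewrite !act_ltE; apply: blt_total => e; apply: ne; rewrite e.
Qed.

Lemma act_mull z x y : act_lt x y -> act_lt (z * x) (z * y).
Proof.
have [[[u ->] [v ->]] [w ->]] := (aut_surj x, aut_surj y, aut_surj z).
by rewrite -!gmulfM !act_ltE; exact: blt_mull.
Qed.

Lemma act_mulr z x y : act_lt x y -> act_lt (x * z) (y * z).
Proof.
have [[[u ->] [v ->]] [w ->]] := (aut_surj x, aut_surj y, aut_surj z).
by rewrite -!gmulfM !act_ltE; exact: blt_mulr.
Qed.

Definition act : biorder G :=
  Biorder act_irr act_trans act_total act_mull act_mulr.

Lemma poscone_act : poscone act = s @` poscone o.
Proof.
by apply/seteqP; split=> x; rewrite /poscone /= /act_lt invg1 mul1g.
Qed.

End Action.

Definition orbit_of (G : groupType) (o : biorder G) : set (biorder G) :=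
  [set act s o | s in [set: aut G]].

(* Main.v *)
Require Import Defs.
From HB Require Import structures.
From mathcomp Require Import all_boot all_order all_algebra.
From mathcomp Require Import boolp classical_sets functions cardinality.
From mathcomp Require Import topology.
From mathcomp Require Import zify ring lra.
Import Order.TTheory GRing.Theory Num.Theory.

(** Write [c] for the commutator of a basis [(x, y)] of a free group of rank 2.
By a theorem of Nielsen, all bases have the same [c] up to conjugation and
inversion, so the sign of [c], and the way conjugation moves [c] up or down, are
data that a bi-order shows to every basis.

Suppose first that the commutator subgroup is convex, with a bi-order on its
abelianization that conjugation stretches by real factors.  Then there are two
linear functionals on Z^2: [phi], whose sign is the order on the quotient, and
[psi], the logarithm of the factor by which a group element stretches [c].
An automorphism acts on both through its matrix in GL_2(Z) and multiplies the
sign of [c] by the determinant; hence the product of the sign of [c] and the sign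
of the determinant of [(phi, psi)] is constant along orbits.  The patterns
[expanding] and [contracting] below ask for [x], [y], [c] positive and for
opposite behaviours of conjugation by [x] and [y] on [c]; they force opposite
values of this invariant.  Each is given by finitely many inequalities
([expanding_open], [contracting_open]) and each is realized ([free_expanding],
[free_contracting]), so a dense orbit would have to meet both.

A general bi-order has no such convex subgroup, and the determinant is replaced
by combinatorics.  The sets [1 < g] and [c ^ g < c] are semigroups; with their
inverses they behave like four half planes of Z^2, each a quarter turn from the
next.  The bases with a given commutator are permuted by the braid group on three
strands, generated by the moves to [(y * x, y)] and to [(x, x * y)].  It contains
the quarter turn to [(y ^ x, x^-1)], and its relations write every element as a
product of a turn, a positive word in the two generators, and a turn
([braid_orbit_moves]).  Turns rotate the half planes, while positive words
preserve each half plane, which is enough to separate the two patterns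
([positive_image_disjoint], [braid_orbit_disjoint]).

Two classical facts about the free group are proved on the way: bases are
connected by elementary moves ([nielsen_induction]), by cancellation arguments
for the word length; and there is a bi-order ([free_biorder]), from an embedding
into 2 x 2 matrices over Z[t]. *)

Set Implicit Arguments.
Unset Strict Implicit.
Unset Printing Implicit Defensive.

Local Open Scope group_scope.

(** * Generating pairs and reduced words *)

(** Rewriting to right-associated reduced form decides identities that hold in
all groups, once conjugates are unfolded. *)
Ltac group :=
  rewrite ?conjgE ?invgM ?invgK -?mulgA
    ?(mulKg, mulVKg, mulgV, mulVg, mul1g, mulg1).

Definition generates (G : groupType) (x y : G) : Prop :=
  forall Q : G -> Prop, Q 1 -> (forall g h, Q g -> Q h -> Q (g / h)) ->
    Q x -> Q y -> forall g, Q g.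

(** The subgroup carried by a predicate, as a group in its own right: the
universal property of a free group can only be tested on such a type. *)
Section SubgroupType.
Variables (G : groupType) (Q : G -> Prop).
Hypothesis (Q1 : Q 1) (QF : forall g h, Q g -> Q h -> Q (g / h)).

Definition subgroup_pred : {pred G} := fun g => `[< Q g >].

Lemma subgroup_pred_closed : group_closed subgroup_pred.
Proof.
split=> [|g h]; rewrite !unfold_in; first exact/asboolP.
by move=> /asboolP Qg /asboolP Qh; apply/asboolP/QF.
Qed.

Definition subgroup_type (_ : group_closed subgroup_pred) :=
  {g | subgroup_pred g}.

HB.instance Definition _ closed :=
  SubChoice.on (subgroup_type closed).
HB.instance Definition _ closed :=
  SubChoice_isSubGroup.Build G subgroup_pred (subgroup_type closed) closed.
End SubgroupType.

(** The map to the subgroup generated by [a] and [b], followed by the inclusion,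
fixes [a] and [b]; by uniqueness it is the identity, so the subgroup is
everything. *)
Lemma free_on2_generates (F : groupType) (a b : F) :
  free_on2 a b -> generates a b.
Proof.
move=> free Q Q1 QF Qa Qb g.
pose S := subgroup_type (subgroup_pred_closed Q1 QF).
have Sa : subgroup_pred Q a by apply/asboolP.
have Sb : subgroup_pred Q b by apply/asboolP.
have [f [fa fb _]] := free S (Sub a Sa) (Sub b Sb).
have [k [_ _ uniq_k]] := free F a b.
have gE : g = val (f g).
  transitivity (k g).
    exact: (uniq_k (idfun : {grouphom F -> F})).
  symmetry.
  apply: (uniq_k ((val : S -> F) \o f : {grouphom F -> F})) => /=.
    by rewrite fa SubK.
  by rewrite fb SubK.
by rewrite gE; apply/asboolP; exact: (valP (f g)).
Qed.

Lemma generates_surj (G H : groupType) (s : {grouphom G -> H}) x y :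
  bijective s -> generates (s x) (s y) <-> generates x y.
Proof.
case=> t tK sK; split=> gen Q Q1 QF Qx Qy g.
  rewrite -(tK g); apply: (gen (Q \o t)) => /=; rewrite ?tK //.
    by have <- : s 1 = 1 by [exact: gmulf1]; rewrite tK.
  move=> h k Qh Qk.
  by rewrite -(sK h) -(sK k) -gmulfF tK; apply: QF.
rewrite -(sK g); apply: (gen (Q \o s)) => //=; first by rewrite gmulf1.
by move=> h k Qh Qk; rewrite gmulfF; apply: QF.
Qed.

(** The first component selects a generator, the second one is [false] for its
inverse. *)
Definition letter := (bool * bool)%type.
Definition letter_inv (l : letter) : letter := (l.1, ~~ l.2).
Definition word_inv (u : seq letter) := rev (map letter_inv u).
Definition reduced (u : seq letter) := sorted (fun l k => k != letter_inv l) u.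

Lemma letter_invK : involutive letter_inv.
Proof. by case=> z s; rewrite /letter_inv /= negbK. Qed.

Lemma letter_inv_neq l : l != letter_inv l.
Proof. by case: l => [z []]; rewrite /letter_inv xpair_eqE /= andbF. Qed.

Lemma neq_letter_inv k l : (k != letter_inv l) = (l != letter_inv k).
Proof. by rewrite -(inj_eq (can_inj letter_invK)) letter_invK eq_sym. Qed.

Lemma reduced_word_inv u : reduced (word_inv u) = reduced u.
Proof.
rewrite /reduced /word_inv rev_sorted sorted_map.
by apply: eq_sorted => l k /=; rewrite letter_invK eq_sym neq_letter_inv eq_sym.
Qed.

Section Words.
Variables (G : groupType) (x y : G).

Definition letter_eval (l : letter) : G :=
  let g := if l.1 then x else y in if l.2 then g else g^-1.
Definition word_eval (u : seq letter) : G :=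
  foldr (fun l g => letter_eval l * g) 1 u.

Lemma letter_evalV l : letter_eval (letter_inv l) = (letter_eval l)^-1.
Proof. by case: l => [[] []]; rewrite /letter_eval /= ?invgK. Qed.

Lemma word_eval_cat u v : word_eval (u ++ v) = word_eval u * word_eval v.
Proof. by elim: u => [|l u IHu] /=; rewrite ?mul1g // IHu mulgA. Qed.

Lemma word_evalV u : word_eval (word_inv u) = (word_eval u)^-1.
Proof.
rewrite /word_inv; elim: u => [|l u IHu] /=; first by rewrite invg1.
by rewrite rev_cons -cats1 word_eval_cat IHu /= letter_evalV mulg1
  invgM.
Qed.

Lemma word_eval_reduce u : exists2 v, reduced v & word_eval v = word_eval u.
Proof.
elim: u => [|l u [v rv ev]] /=; first by exists [::].
case: v rv ev => [|k v] rv /= <-; first by exists [:: l].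
have [kl|kl] := eqVneq k (letter_inv l).
  exists v; first exact: path_sorted rv.
  by rewrite kl letter_evalV mulVKg.
by exists (l :: k :: v); rewrite //= kl.
Qed.

Lemma generates_word : generates x y ->
  forall g, exists2 u, reduced u & word_eval u = g.
Proof.
move=> gen g; suff [u <-] : exists u, word_eval u = g.
  exact: word_eval_reduce.
apply: (gen (fun g => exists u, word_eval u = g)).
- by exists [::].
- move=> h k [u <-] [v <-]; exists (u ++ word_inv v).
  by rewrite word_eval_cat word_evalV.
- by exists [:: (true, true)]; rewrite /= mulg1.
- by exists [:: (false, true)]; rewrite /= mulg1.
Qed.

End Words.

(** * A bi-order on the free group *)
Section CongruenceGroup.
Local Open Scope ring_scope.

Local Notation M := 'M[{poly int}]_2.

(** The bi-order lives on the matrices over Z[t] that reduce to 1 at t = 0.  To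
compare two of them, look at the lowest power of t at which they differ:
multiplying the difference by a matrix that is 1 at t = 0, on either side, does
not change its lowest coefficient.  That coefficient is an integer matrix, and
these form a group for addition alone, so any order on it compatible with
addition will do, such as the lexicographic one. *)
Definition at0 : M -> 'M[int]_2 := map_mx (horner_eval 0).

Lemma at0D : {morph at0 : A B / A + B}.
Proof. exact: map_mxD. Qed.
Lemma at0N : {morph at0 : A / - A}.
Proof. exact: map_mxN. Qed.
Lemma at0_1 : at0 1 = 1.
Proof. exact: map_mx1. Qed.
Lemma at0M : {morph at0 : A B / A * B}.
Proof. by move=> A B; exact: map_mxM. Qed.
Lemma at0Z p A : at0 (p *: A) = p.[0] *: at0 A.
Proof. exact: map_mxZ. Qed.

Definition lexpos (D : 'M[int]_2) : Prop :=
  0 < D 0 0 \/ D 0 0 = 0 /\ (0 < D 0 1 \/ D 0 1 = 0 /\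
  (0 < D 1 0 \/ D 1 0 = 0 /\ 0 < D 1 1)).

Lemma lexpos0 : ~ lexpos 0.
Proof. rewrite /lexpos !mxE; lia. Qed.

Lemma lexposD D E : lexpos D -> lexpos E -> lexpos (D + E).
Proof.
rewrite /lexpos !mxE.
move: (D 0 0) (D 0 1) (D 1 0) (D 1 1) (E 0 0) (E 0 1) (E 1 0) (E 1 1).
move=> d1 d2 d3 d4 e1 e2 e3 e4.
lia.
Qed.

Lemma lexpos_total D : D != 0 -> lexpos D \/ lexpos (- D).
Proof.
have ord2 (i : 'I_2) : i = 0 \/ i = 1.
  by case: i => [[|[|?]] ?] //; [left|right]; apply: val_inj.
move=> D0.
have nz : ~ (D 0 0 = 0 /\ D 0 1 = 0 /\ D 1 0 = 0 /\ D 1 1 = 0).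
  move=> [D00 [D01 [D10 D11]]]; case/eqP: D0; apply/matrixP => i j.
  by rewrite mxE; case: (ord2 i) (ord2 j) => -> [] ->.
move: nz; rewrite /lexpos !mxE.
move: (D 0 0) (D 0 1) (D 1 0) (D 1 1) => d1 d2 d3 d4.
lia.
Qed.

Definition lowpos (E : M) : Prop :=
  exists n E', E = 'X^n *: E' /\ lexpos (at0 E').

Lemma lowpos0 : ~ lowpos 0.
Proof.
case=> n [E [XE0 Epos]]; apply: lexpos0; suff <- : at0 E = 0 by [].
apply/matrixP => i j; rewrite !mxE.
move/matrixP/(_ i j): XE0 => /esym/eqP.
rewrite !mxE mulf_eq0 (negPf (monic_neq0 (monicXn _ n))) /= => /eqP->.
by rewrite /horner_eval horner0.
Qed.

Lemma lowposD E F : lowpos E -> lowpos F -> lowpos (E + F).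
Proof.
have lowpos_lt n m A B : (n < m)%N -> lexpos (at0 A) ->
    lowpos ('X^n *: A + 'X^m *: B).
  move=> nm Apos; exists n, (A + 'X^(m - n) *: B).
  rewrite scalerDr scalerA -exprD subnKC ?(ltnW nm) //; split=> //.
  by rewrite at0D at0Z hornerXn expr0n subn_eq0 leqNgt nm scale0r addr0.
move=> [n [A [-> Apos]]] [m [B [-> Bpos]]].
case: (ltngtP n m) => [nm|mn|->]; first exact: lowpos_lt.
  by rewrite addrC; exact: lowpos_lt.
by exists m, (A + B); rewrite scalerDr at0D; split=> //; exact: lexposD.
Qed.

Lemma lowposMl A E : at0 A = 1 -> lowpos E -> lowpos (A * E).
Proof.
move=> A1 [n [B [-> Bpos]]]; exists n, (A * B).
by rewrite at0M A1 mul1r -scalerAr.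
Qed.

Lemma lowposMr A E : at0 A = 1 -> lowpos E -> lowpos (E * A).
Proof.
move=> A1 [n [B [-> Bpos]]]; exists n, (B * A).
by rewrite at0M A1 mulr1 -scalerAl.
Qed.

(** Divide by t as long as the value at 0 vanishes; the sizes of the entries
decrease. *)
Lemma lowpos_total E : E != 0 -> lowpos E \/ lowpos (- E).
Proof.
have [m sizeE] : exists m, forall i j, (size (E i j) <= m)%N.
  exists (\max_i \max_j size (E i j)) => i j.
  apply: leq_trans (leq_bigmax i).
  exact: (leq_bigmax (F := fun j => size (E i j))).
elim: m E sizeE => [|m IHm] E sizeE E0.
  case/eqP: E0; apply/matrixP => i j; rewrite mxE; apply/eqP.
  by rewrite -size_poly_eq0 -leqn0.
have [E00|E00] := eqVneq (at0 E) 0; last first.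
  have [pos|pos] := lexpos_total E00; [left|right].
    by exists 0, E; rewrite expr0 scale1r.
  by exists 0, (- E); rewrite expr0 scale1r at0N.
pose E' : M := map_mx (drop_poly 1) E.
have EE' : E = 'X *: E'.
  apply/matrixP => i j; rewrite !mxE; apply/polyP => k.
  rewrite coefXM coef_drop_poly; case: k => [|k] /=; last by rewrite addn1.
  rewrite -horner_coef0.
  by move/matrixP/(_ i j): E00; rewrite !mxE.
have size' i j : (size (E' i j) <= m)%N.
  by rewrite mxE size_drop_poly leq_subLR; exact: sizeE.
have E'0 : E' != 0 by apply: contra_neq E0 => E'0; rewrite EE' E'0 scaler0.
case: (IHm E' size' E'0) => [] [n [B [EB Bpos]]]; [left|right];
  exists n.+1, B; split=> //.
  by rewrite EE' EB scalerA exprS.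
by rewrite EE' -scalerN EB scalerA exprS.
Qed.

Definition cong_pred : pred M := fun A => (A \is a GRing.unit) && (at0 A == 1).
Definition cong := {A : M | cong_pred A}.
HB.instance Definition _ := SubChoice.on cong.

Lemma cong_unit (A : cong) : val A \is a GRing.unit.
Proof. by case/andP: (valP A). Qed.
Lemma cong_at0 (A : cong) : at0 (val A) = 1.
Proof. by case/andP: (valP A) => _ /eqP. Qed.

Lemma cong_pred1 : cong_pred 1.
Proof. by rewrite /cong_pred unitr1 at0_1 eqxx. Qed.

Lemma cong_predM (A B : cong) : cong_pred (val A * val B).
Proof.
rewrite /cong_pred; apply/andP; split.
  by rewrite unitrMl; exact: cong_unit.
by rewrite at0M !cong_at0 mulr1.
Qed.

Lemma cong_predV (A : cong) : cong_pred (val A)^-1.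
Proof.
rewrite /cong_pred unitrV cong_unit /=; apply/eqP.
by rewrite -[LHS]mul1r -[X in X * _](cong_at0 A) -at0M divrr ?cong_unit //
  at0_1.
Qed.

Definition cong1 : cong := Sub 1 cong_pred1.
Definition congM (A B : cong) : cong := Sub (val A * val B) (cong_predM A B).
Definition congV (A : cong) : cong := Sub (val A)^-1 (cong_predV A).

Lemma congA : associative congM.
Proof. by move=> A B C; apply: val_inj; rewrite /= mulrA. Qed.
Lemma cong1M : left_id cong1 congM.
Proof. by move=> A; apply: val_inj; rewrite /= mul1r. Qed.
Lemma congM1 : right_id cong1 congM.
Proof. by move=> A; apply: val_inj; rewrite /= mulr1. Qed.
Lemma congVM : left_inverse cong1 congV congM.
Proof. by move=> A; apply: val_inj; rewrite /= mulVr ?cong_unit. Qed.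
Lemma congMV : right_inverse cong1 congV congM.
Proof. by move=> A; apply: val_inj; rewrite /= divrr ?cong_unit. Qed.

HB.instance Definition _ :=
  isGroup.Build cong congA cong1M congM1 congVM congMV.

Lemma val_congM (A B : cong) : val (A * B)%g = val A * val B.
Proof. by []. Qed.
Definition cong_lt (A B : cong) : Prop := lowpos (val B - val A).

Lemma cong_lt_irr A : ~ cong_lt A A.
Proof. by rewrite /cong_lt subrr; exact: lowpos0. Qed.

Lemma cong_lt_trans A B C : cong_lt A B -> cong_lt B C -> cong_lt A C.
Proof.
move=> AB BC; rewrite /cong_lt -(subrKA (val B)) addrC.
by move: (lowposD AB BC); rewrite addrC.
Qed.

Lemma cong_lt_total A B : A <> B -> cong_lt A B \/ cong_lt B A.
Proof.
move=> AB; rewrite /cong_lt -(opprB (val B)); apply: lowpos_total.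
by rewrite subr_eq0; apply/eqP => /val_inj/esym.
Qed.

Lemma cong_lt_mull C A B : cong_lt A B -> cong_lt (C * A)%g (C * B)%g.
Proof.
by rewrite /cong_lt !val_congM -mulrBr; apply: lowposMl; exact: cong_at0.
Qed.

Lemma cong_lt_mulr C A B : cong_lt A B -> cong_lt (A * C)%g (B * C)%g.
Proof.
by rewrite /cong_lt !val_congM -mulrBl; apply: lowposMr; exact: cong_at0.
Qed.

Definition cong_order : biorder cong :=
  Biorder cong_lt_irr cong_lt_trans cong_lt_total cong_lt_mull cong_lt_mulr.

End CongruenceGroup.

(** The elementary matrices with off-diagonal entry t generate a free group.  The
proof applies a reduced word to the vector (1, 1): each letter adds t times one
entry to the other entry, and the entry modified last has the larger degree. *)
Section Sanov.
Local Open Scope ring_scope.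
Local Notation M := 'M[{poly int}]_2.

Definition row_of (z : bool) : 'I_2 := if z then 0 else 1.

Definition elem (z s : bool) : M :=
  1 + ((-1) ^+ (~~ s) * 'X) *: delta_mx (row_of z) (row_of (~~ z)).

Lemma elemMN z s : elem z s * elem z (~~ s) = 1.
Proof.
rewrite /elem mulrDl mul1r mulrDr mulr1 -scalerAl -scalerAr.
rewrite (_ : delta_mx _ _ * _ = 0); last first.
  by apply: mul_delta_mx_0; case: z.
rewrite !scaler0 addr0 -addrA -scalerDl.
by case: s; rewrite /= ?expr0 ?expr1 !mulN1r mul1r ?addNr ?subrr scale0r addr0.
Qed.

Lemma elem_cong z s : cong_pred (elem z s).
Proof.
apply/andP; split.
  apply/unitrP; exists (elem z (~~ s)); split; last exact: elemMN.
  by have := elemMN z (~~ s); rewrite negbK.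
by rewrite at0D at0_1 at0Z hornerM hornerX mulr0 scale0r addr0.
Qed.

Definition elemg z s : cong := Sub (elem z s) (elem_cong z s).

Lemma letter_eval_elemg l :
  letter_eval (elemg true true) (elemg false true) l = elemg l.1 l.2.
Proof.
have elemV z : (elemg z true)^-1%g = elemg z false.
  by apply: mulg1_eq; apply: val_inj; exact: elemMN.
by case: l => [[] []]; rewrite /letter_eval /= ?elemV.
Qed.

Definition ones : 'cV[{poly int}]_2 := const_mx 1.

Lemma elem_mul z s (v : 'cV[{poly int}]_2) k :
  (elem z s *m v) k 0 =
    v k 0 + (k == row_of z)%:R * ((-1) ^+ (~~ s) * 'X * v (row_of (~~ z)) 0).
Proof.
rewrite mulmxDl mul1mx mxE; congr (_ + _).
rewrite -scalemxAl !mxE (bigD1 (row_of (~~ z))) //= big1 ?addr0.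
  by rewrite !mxE eqxx andbT mulrCA.
by move=> j /negPf jz; rewrite !mxE jz andbF mul0r.
Qed.

(** The sign condition on the two leading coefficients says that a further letter
equal to the last one does not cancel the leading term.  [dominated] is what must
hold before a letter of sign [s] modifies [p]: in the case of a new generator, the
coefficient of [p] at the size of [q] is 0. *)
Definition dominated (s : bool) (p q : {poly int}) :=
  [/\ q != 0, (size p <= (size q).+1)%N
    & 0 <= (-1) ^+ (~~ s) * (p`_(size q) * lead_coef q)].

Definition dominates (s : bool) (p q : {poly int}) :=
  [/\ q != 0, size p = (size q).+1
    & 0 < (-1) ^+ (~~ s) * (p`_(size q) * lead_coef q)].

Lemma dominated_step s p q : dominated s p q ->
  dominates s (p + (-1) ^+ (~~ s) * 'X * q) q.
Proof.
move=> [q0 pq cpq].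
have szq : size ((-1) ^+ (~~ s) * 'X * q) = (size q).+1.
  rewrite -mulrA mulr_sign.
  by case: s {cpq}; rewrite /= ?size_polyN mulrC size_mulX.
have pos : 0 < (-1) ^+ (~~ s) *
    ((p + (-1) ^+ (~~ s) * 'X * q)`_(size q) * lead_coef q).
  rewrite coefD mulrDl mulrDr ltr_wpDl //.
  have -> : ((-1) ^+ (~~ s) * 'X * q)`_(size q) = (-1) ^+ (~~ s) * lead_coef q.
    rewrite -mulrA -[in LHS]signr_odd !mulr_sign.
    case: s {szq cpq} => /=;
      by rewrite ?coefN mulrC coefMX size_poly_eq0 (negPf q0).
  rewrite mulrA mulrA -expr2 sqrr_sign mul1r -expr2.
  by rewrite exprn_even_gt0 //= lead_coef_eq0.
split=> //; apply/eqP; rewrite eqn_leq; apply/andP; split.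
  by apply: leq_trans (size_polyD _ _) _; rewrite geq_max pq szq /=.
rewrite ltnNge; apply/negP => le; move: pos.
by rewrite nth_default // mul0r mulr0 ltxx.
Qed.

Lemma dominated_switch s t p q : dominates s p q -> dominated t q p.
Proof.
move=> [q0 pq _]; split; first by rewrite -size_poly_eq0 pq.
  by rewrite pq -addn2 leq_addr.
by rewrite nth_default ?pq // mul0r mulr0.
Qed.

Lemma dominates_dominated s p q : dominates s p q -> dominated s p q.
Proof. by move=> [q0 pq /ltW c]; split; rewrite ?pq. Qed.

Definition sanov u : cong := word_eval (elemg true true) (elemg false true) u.
Definition sanov_vec u : 'cV[{poly int}]_2 := val (sanov u) *m ones.

Lemma sanov_vec_cons l u :
  sanov_vec (l :: u) = elem l.1 l.2 *m sanov_vec u.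
Proof. by rewrite /sanov_vec /sanov /= letter_eval_elemg mulmxA. Qed.

Lemma sanov_dominates l u : reduced (l :: u) ->
  dominates l.2 (sanov_vec (l :: u) (row_of l.1) 0)
                (sanov_vec (l :: u) (row_of (~~ l.1)) 0).
Proof.
elim: u l => [|k u IHu] [z s] red; rewrite sanov_vec_cons !elem_mul /=;
  (have -> : (row_of (~~ z) == row_of z) = false by case: z {red});
  rewrite eqxx mul1r mul0r addr0; apply: dominated_step.
  rewrite /sanov_vec mul1mx !mxE; split; rewrite ?oner_eq0 ?size_poly1 //.
  by rewrite nth_default ?size_poly1 // mul0r mulr0.
have /andP[/= kzs redu] := red.
have := IHu k redu; case: k kzs {red redu IHu} => [y t] /=.
rewrite /letter_inv xpair_eqE /=.
have [->|yz] := eqVneq y z; last first.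
  have -> : y = ~~ z by case: y z yz => [] [].
  by rewrite negbK => _; exact: dominated_switch.
have [->|ts] := eqVneq t s; first by move=> _; exact: dominates_dominated.
have -> : t = ~~ s by case: t s ts => [] [].
by rewrite eqxx.
Qed.

Lemma sanov_neq1 u : reduced u -> u != [::] -> sanov u != 1%g.
Proof.
case: u => // l u red _; apply/negP => /eqP lu1.
have [_ + _] := sanov_dominates red.
by rewrite /sanov_vec lu1 mul1mx !mxE => /eqP; rewrite size_poly1.
Qed.

End Sanov.

(** * Orders of the two patterns *)
Section PullLex.
Local Open Scope group_scope.
Variables (G H : groupType) (f : {grouphom G -> H}) (oH : biorder H).

Section Pullback.
Hypothesis f_inj : injective f.
Definition pullback_lt (x y : G) : Prop := oH (f x) (f y).

Lemma pullback_irr x : ~ pullback_lt x x.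
Proof. exact: blt_irr. Qed.
Lemma pullback_trans x y z :
  pullback_lt x y -> pullback_lt y z -> pullback_lt x z.
Proof. exact: blt_trans. Qed.
Lemma pullback_total x y : x <> y -> pullback_lt x y \/ pullback_lt y x.
Proof. by move=> xy; apply: blt_total => /f_inj. Qed.
Lemma pullback_mull z x y : pullback_lt x y -> pullback_lt (z * x) (z * y).
Proof. by rewrite /pullback_lt !gmulfM; exact: blt_mull. Qed.
Lemma pullback_mulr z x y : pullback_lt x y -> pullback_lt (x * z) (y * z).
Proof. by rewrite /pullback_lt !gmulfM; exact: blt_mulr. Qed.

Definition pullback : biorder G :=
  Biorder pullback_irr pullback_trans pullback_total pullback_mull
    pullback_mulr.
End Pullback.

(** A bi-order on a quotient is lifted by breaking ties with a bi-order of the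
whole group, so that the image is free to be any bi-ordered group. *)
Section Lex.
Variable oG : biorder G.
Definition lex_lt (x y : G) : Prop := oH (f x) (f y) \/ f x = f y /\ oG x y.

Lemma lex_irr x : ~ lex_lt x x.
Proof. by case=> [/blt_irr|[_ /blt_irr]]. Qed.
Lemma lex_trans x y z : lex_lt x y -> lex_lt y z -> lex_lt x z.
Proof.
case=> [xy|[xy oxy]] [yz|[yz oyz]].
- by left; apply: blt_trans yz.
- by left; rewrite -yz.
- by left; rewrite xy.
- by right; split; [rewrite xy | apply: blt_trans oyz].
Qed.
Lemma lex_total x y : x <> y -> lex_lt x y \/ lex_lt y x.
Proof.
move=> xy; have [fxy|fxy] := pselect (f x = f y).
  by case: (blt_total oG xy) => ?; [left|right]; right.
by case: (blt_total oH fxy) => ?; [left|right]; left.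
Qed.
Lemma lex_mull z x y : lex_lt x y -> lex_lt (z * x) (z * y).
Proof.
rewrite /lex_lt !gmulfM => -[xy|[-> xy]]; first by left; apply: blt_mull.
by right; split=> //; apply: blt_mull.
Qed.
Lemma lex_mulr z x y : lex_lt x y -> lex_lt (x * z) (y * z).
Proof.
rewrite /lex_lt !gmulfM => -[xy|[-> xy]]; first by left; apply: blt_mulr.
by right; split=> //; apply: blt_mulr.
Qed.

Definition lex : biorder G :=
  Biorder lex_irr lex_trans lex_total lex_mull lex_mulr.

Lemma lex_ltl x y : oH (f x) (f y) -> lex x y.
Proof. by left. Qed.
End Lex.
End PullLex.

Section Free.
Local Open Scope group_scope.
Variables (F : groupType) (a b : F).
Hypothesis free : free_on2 a b.

Lemma gmulf_word_eval (G H : groupType) (f : {grouphom G -> H}) x y u :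
  f (word_eval x y u) = word_eval (f x) (f y) u.
Proof.
elim: u => [|l u IHu] /=; first exact: gmulf1.
by rewrite gmulfM IHu; case: l => [[] []]; rewrite /letter_eval /= ?gmulfV.
Qed.

Lemma word_eval_free_eq1 u : reduced u -> word_eval a b u = 1 -> u = [::].
Proof.
have [f [fa fb _]] := free (elemg true true) (elemg false true).
move=> red u1; apply: contraTeq isT => /(sanov_neq1 red).
by rewrite /sanov -fa -fb -gmulf_word_eval u1 gmulf1 eqxx.
Qed.

Lemma free_biorder : inhabited (biorder F).
Proof.
have [f [fa fb _]] := free (elemg true true) (elemg false true).
apply: inhabits; apply: (pullback cong_order (f := f)).
apply: gmulf_inj => g.
have [u red <-] := generates_word (free_on2_generates free) g.
move=> fu1; suff -> : u = [::] by [].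
apply: contraTeq isT => /(sanov_neq1 red).
by rewrite /sanov -fa -fb -gmulf_word_eval fu1 eqxx.
Qed.
End Free.

(** A triple [(m, e, u)] is the affine map of slope [2 ^ e] and constant term [u],
together with a degree [m] that dominates the order.  The degree makes both
generators positive whatever their slopes.  Their commutator is a translation,
and conjugation by a map of slope [2 ^ e] divides a translation by [2 ^ e]; so
the slopes 1/2 and 2, in one order or the other, realize the two patterns. *)
Section Affine.
Local Open Scope ring_scope.

Definition aff : Type := (int * int * rat)%type.
HB.instance Definition _ := Choice.on aff.

Implicit Types (g h k : aff).

Definition aff1 : aff := (0, 0, 0).
Definition affM g h : aff :=
  (g.1.1 + h.1.1, g.1.2 + h.1.2, g.2 + 2 ^ g.1.2 * h.2).
Definition affV g : aff := (- g.1.1, - g.1.2, - (2 ^ (- g.1.2) * g.2)).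

Lemma exp2D (m n : int) : (2 : rat) ^ (m + n) = 2 ^ m * 2 ^ n.
Proof. by rewrite expfzDr. Qed.

Lemma affA : associative affM.
Proof.
move=> g h k; rewrite /affM /= !addrA exp2D; congr (_, _).
by rewrite mulrDr !addrA mulrA.
Qed.
Lemma aff1M : left_id aff1 affM.
Proof. by case=> [[m e] u]; rewrite /affM /= !add0r expr0z mul1r. Qed.
Lemma affM1 : right_id aff1 affM.
Proof. by case=> [[m e] u]; rewrite /affM /= mulr0 !addr0. Qed.
Lemma affVM : left_inverse aff1 affV affM.
Proof. by case=> [[m e] u]; rewrite /affM /affV /= !addNr. Qed.
Lemma affMV : right_inverse aff1 affV affM.
Proof.
case=> [[m e] u]; rewrite /affM /affV /= !subrr.
by rewrite mulrN mulrA -exp2D subrr expr0z mul1r subrr.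
Qed.

HB.instance Definition _ := isGroup.Build aff affA aff1M affM1 affVM affMV.

Lemma affE g h : (g * h)%g = affM g h.
Proof. by []. Qed.

Definition aff_lt g h : Prop :=
  g.1.1 < h.1.1 \/ g.1.1 = h.1.1 /\
  (g.1.2 < h.1.2 \/ g.1.2 = h.1.2 /\ g.2 < h.2).

Lemma aff_lt_irr g : ~ aff_lt g g.
Proof. by rewrite /aff_lt !ltxx; intuition. Qed.

Lemma aff_lt_trans g h k : aff_lt g h -> aff_lt h k -> aff_lt g k.
Proof.
rewrite /aff_lt => -[gh|[-> gh]] [hk|[<- hk]]; [left|left|left|right] => //.
  exact: lt_trans hk.
split=> //.
case: gh hk => [gh|[-> gh]] [hk|[<- hk]]; [left|left|left|right] => //.
  exact: lt_trans hk.
by split=> //; exact: lt_trans hk.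
Qed.

Lemma aff_lt_total g h : g <> h -> aff_lt g h \/ aff_lt h g.
Proof.
case: g h => [[m e] u] [[n f] v]; rewrite /aff_lt /= => ne.
case: (ltgtP m n) => mn; [by left; left | by right; left |].
case: (ltgtP e f) => ef; [by left; right; split=> //; left
  | by right; right; split=> //; left |].
case: (ltgtP u v) => uv.
- by left; right; split=> //; right.
- by right; right; split=> //; right.
- by case: ne; rewrite mn ef uv.
Qed.

Lemma aff_lt_mull k g h : aff_lt g h -> aff_lt (k * g)%g (k * h)%g.
Proof.
rewrite /aff_lt !affE /= !ltrD2l => -[gh|[-> gh]];
  [by left | right; split=> //].
case: gh => [gh|[-> gh]]; [by left | right; split=> //].
by rewrite ltr_pM2l // exprz_gt0.
Qed.

Lemma aff_lt_mulr k g h : aff_lt g h -> aff_lt (g * k)%g (h * k)%g.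
Proof.
rewrite /aff_lt !affE /= !ltrD2r => -[gh|[-> gh]];
  [by left | right; split=> //].
case: gh => [gh|[-> gh]]; [by left | right; split=> //].
by rewrite ltrD2r.
Qed.

Definition aff_order : biorder aff :=
  Biorder aff_lt_irr aff_lt_trans aff_lt_total aff_lt_mull aff_lt_mulr.

End Affine.

Section Patterns.
Local Open Scope group_scope.

(** Conjugation by [x] and by [y] move the commutator in opposite directions; the
two patterns differ by the exchange of these directions. *)
Definition expanding (G : groupType) (o : biorder G) (x y : G) : Prop :=
  [/\ o 1 x, o 1 y, o 1 [~ x, y],
      o [~ x, y] ([~ x, y] ^ x) & o ([~ x, y] ^ y) [~ x, y]].
Definition contracting (G : groupType) (o : biorder G) (x y : G) : Prop :=
  [/\ o 1 x, o 1 y, o 1 [~ x, y],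
      o ([~ x, y] ^ x) [~ x, y] & o [~ x, y] ([~ x, y] ^ y)].

Lemma affVE (g : aff) : g^-1 = affV g.
Proof. by []. Qed.

Section AffineComputations.
Local Open Scope ring_scope.

Lemma exp2_neq0 (e : int) : (2 : rat) ^ e != 0.
Proof. by rewrite expfz_neq0. Qed.

Lemma exp2N (e : int) : (2 : rat) ^ (- e) = (2 ^ e)^-1.
Proof. by rewrite invr_expz. Qed.

Lemma aff_commutator (m n e f : int) (v : rat) :
  ([~ (m, e, 0) : aff, (n, f, v)])%g =
    (0, 0, (2 ^ e - 1) * v / (2 ^ e * 2 ^ f)).
Proof.
rewrite /commg /conjg !affVE !affE /affM /affV /= !exp2N.
congr (_, _, _); [lia | lia |].
move: (2 ^ e) (2 ^ f) (exp2_neq0 e) (exp2_neq0 f) => p q p0 q0.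
by field; rewrite p0 q0.
Qed.

Lemma aff_conj_translation (w : rat) (m e : int) u :
  (((0, 0, w) : aff) ^ ((m, e, u) : aff))%g = (0, 0, w / 2 ^ e) :> aff.
Proof.
rewrite /conjg !affVE !affE /affM /affV /= !exp2N expr0z.
congr (_, _, _); [lia | lia |].
move: (2 ^ e) (exp2_neq0 e) => p p0.
by field.
Qed.

Lemma aff_lt_translation (u v : rat) : u < v -> aff_order (0, 0, u) (0, 0, v).
Proof. by move=> uv; right; split=> //; right. Qed.

Lemma aff_lt_degree (m e : int) (u : rat) : 0 < m -> aff_order 1%g (m, e, u).
Proof. by left. Qed.

Lemma aff_expanding : expanding aff_order (1, -1, 0) (1, 1, -2).
Proof.
rewrite /expanding aff_commutator !aff_conj_translation exp2N expr1z.
split; [exact: aff_lt_degree | exact: aff_lt_degree | | | ];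
  apply: aff_lt_translation; lra.
Qed.

Lemma aff_contracting : contracting aff_order (1, 1, 0) (1, -1, 1).
Proof.
rewrite /contracting aff_commutator !aff_conj_translation exp2N expr1z.
split; [exact: aff_lt_degree | exact: aff_lt_degree | | | ];
  apply: aff_lt_translation; lra.
Qed.
End AffineComputations.

Section Free.
Variables (F : groupType) (a b : F).
Hypothesis free : free_on2 a b.

Lemma free_expanding : exists o : biorder F, expanding o a b.
Proof.
have [o] := free_biorder free.
have [f [fa fb _]] := free ((1, -1, 0)%R : aff) ((1, 1, -2)%R : aff).
exists (lex f aff_order o).
by case: aff_expanding => *; split; apply: lex_ltl;
  rewrite ?gmulfJ ?gmulfR ?gmulf1 ?fa ?fb.
Qed.

Lemma free_contracting : exists o : biorder F, contracting o a b.
Proof.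
have [o] := free_biorder free.
have [f [fa fb _]] := free ((1, 1, 0)%R : aff) ((1, -1, 1)%R : aff).
exists (lex f aff_order o).
by case: aff_contracting => *; split; apply: lex_ltl;
  rewrite ?gmulfJ ?gmulfR ?gmulf1 ?fa ?fb.
Qed.
End Free.
End Patterns.

(** * Word length *)
Fixpoint lcp (T : eqType) (u v : seq T) : nat :=
  match u, v with
  | l :: u', k :: v' => if l == k then (lcp u' v').+1 else 0
  | _, _ => 0
  end.

Section Lcp.
Variable T : eqType.
Implicit Types u v w : seq T.

Lemma lcp_ultrametric u v w : minn (lcp u v) (lcp v w) <= lcp u w.
Proof.
elim: u v w => [|l u IHu] [|k v] [|j w] //=; rewrite ?(min0n, minn0) //.
have [->|_] := eqVneq l k; last by rewrite min0n.
by case: eqP => _; rewrite ?minn0 // minnSS ltnS.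
Qed.

Lemma lcp_split u v : exists w u' v', [/\ u = w ++ u', v = w ++ v',
  size w = lcp u v
  & forall l k, ohead u' = Some l -> ohead v' = Some k -> l != k].
Proof.
elim: u v => [|l u IHu] [|k v] /=; [by exists [::], [::], [::] |
  by exists [::], [::], (k :: v) | by exists [::], (l :: u), [::] |].
case: eqP => [<-|/eqP lk].
  have [w [u' [v' [-> -> <- uv]]]] := IHu v.
  by exists (l :: w), u', v'.
by exists [::], (l :: u), (k :: v); split=> // ? ? [<-] [<-].
Qed.

Lemma lcp_nth x0 u v i : i < lcp u v -> nth x0 u i = nth x0 v i.
Proof.
elim: u v i => [|l u IHu] [|k v] [|i] //=; case: eqP => // _.
exact: IHu.
Qed.

End Lcp.

Section Length.
Local Open Scope group_scope.
Variables (F : groupType) (a b : F).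
Hypothesis free : free_on2 a b.

Lemma reduced_cat u v : reduced u -> reduced v ->
  (forall l k, ohead (rev u) = Some l -> ohead v = Some k ->
    k != letter_inv l) ->
  reduced (u ++ v).
Proof.
rewrite /reduced; case: u => [|l u] //=; case: v => [|k v]; rewrite ?cats0 //.
rewrite cat_path /= => -> -> uv; rewrite andbT /=; apply: uv => //.
by rewrite lastI rev_rcons.
Qed.

Lemma reduced_catl u v : reduced (u ++ v) -> reduced u.
Proof. by rewrite /reduced => /cat_sorted2[]. Qed.
Lemma reduced_catr u v : reduced (u ++ v) -> reduced v.
Proof. by rewrite /reduced => /cat_sorted2[]. Qed.

Lemma word_eval_free_quotient u v : reduced u -> reduced v ->
  exists w, [/\ reduced w,
    word_eval a b w = (word_eval a b u)^-1 * word_eval a b v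
    & size w + (lcp u v).*2 = size u + size v].
Proof.
move=> ru rv; have [w [u' [v' [uE vE sw uv']]]] := lcp_split u v.
exists (word_inv u' ++ v'); split.
- apply: reduced_cat.
  + by rewrite reduced_word_inv; move: ru; rewrite uE; exact: reduced_catr.
  + by move: rv; rewrite vE; exact: reduced_catr.
  rewrite /word_inv revK; case: u' {uE} uv' => [|l u'] //= uv' _ k [<-] vk.
  by rewrite letter_invK eq_sym; exact: uv'.
- by rewrite word_eval_cat word_evalV uE vE !word_eval_cat; group.
- rewrite -sw uE vE /word_inv !size_cat size_rev size_map -addnn.
  by rewrite addnACA (addnC (size u')) (addnC (size v')).
Qed.

Lemma word_eval_free_inj u v :
  reduced u -> reduced v -> word_eval a b u = word_eval a b v -> u = v.
Proof.
move=> ru rv uv; have [w [rw ew sw]] := word_eval_free_quotient ru rv.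
have w0 : w = [::] by apply: (word_eval_free_eq1 free rw); rewrite ew uv mulVg.
have [w' [u' [v' [uE vE sw' _]]]] := lcp_split u v.
move: sw; rewrite w0 -sw' uE vE !size_cat /= => sw.
suff [/size0nil-> /size0nil->] : size u' = 0 /\ size v' = 0 by [].
by move: sw; move: (size u') (size v') (size w') => p q r; lia.
Qed.

Lemma word_exists g : exists u, reduced u /\ word_eval a b u = g.
Proof.
by have [u ru <-] := generates_word (free_on2_generates free) g; exists u.
Qed.

Definition nf g := sval (cid (word_exists g)).
Definition len g := size (nf g).
(** The distance from the origin to the point where the geodesics to [g] and [h]
part in the Cayley tree, that is, a Gromov product.  Everything below about
lengths follows from [len_gromov], the tree inequality [gromov_ultrametric], the
existence of prefixes and [gromov_inv_lt]. *)
Definition gromov g h := lcp (nf g) (nf h).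

Lemma nf_reduced g : reduced (nf g).
Proof. by rewrite /nf; case: cid => u []. Qed.
Lemma nfK g : word_eval a b (nf g) = g.
Proof. by rewrite /nf; case: cid => u []. Qed.
Lemma nf_word_eval u : reduced u -> nf (word_eval a b u) = u.
Proof.
by move=> ru; apply: word_eval_free_inj; rewrite ?nfK //; exact: nf_reduced.
Qed.

Lemma len_gromov g h : len (g^-1 * h) + (gromov g h).*2 = len g + len h.
Proof.
have [w [rw ew sw]] := word_eval_free_quotient (nf_reduced g) (nf_reduced h).
by rewrite /len -{1}(nfK g) -{1}(nfK h) -ew nf_word_eval.
Qed.

Lemma gromov_ultrametric g h k : minn (gromov g h) (gromov h k) <= gromov g k.
Proof. exact: lcp_ultrametric. Qed.

Lemma nfV g : nf g^-1 = word_inv (nf g).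
Proof.
rewrite -{1}(nfK g) -word_evalV nf_word_eval // reduced_word_inv.
exact: nf_reduced.
Qed.

Lemma lenV g : len g^-1 = len g.
Proof. by rewrite /len nfV size_rev size_map. Qed.

Lemma lenVV g h : len (g^-1 * h^-1) = len (h * g).
Proof. by rewrite -(lenV (h * g)) invgM. Qed.

Lemma gromovC g h : gromov g h = gromov h g.
Proof.
have E : len (h^-1 * g) = len (g^-1 * h) by rewrite -lenV invgM invgK.
have := len_gromov h g; have := len_gromov g h; rewrite E; lia.
Qed.

Lemma len_eq0 g : len g = 0 -> g = 1.
Proof. by move=> /size0nil g0; rewrite -(nfK g) g0. Qed.

Lemma len_prefix g n : n <= len g ->
  exists2 p, len p = n & len (p^-1 * g) = len g - n.
Proof.
move=> ng; exists (word_eval a b (take n (nf g))).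
  rewrite /len nf_word_eval ?size_takel //.
  by apply: reduced_catl (drop n (nf g)) _; rewrite cat_take_drop nf_reduced.
rewrite -{2}(nfK g) -{2}(cat_take_drop n (nf g)) word_eval_cat mulKg.
rewrite /len nf_word_eval ?size_drop //.
by apply: reduced_catr (take n (nf g)) _ _; rewrite cat_take_drop nf_reduced.
Qed.

(** A word cannot cancel half of itself in a square: the middle letter, or the two
middle letters, would be inverse to themselves, or to each other. *)
Lemma gromov_inv_lt g : g <> 1 -> (gromov g^-1 g).*2 < len g.
Proof.
move=> g1; rewrite ltnNge; apply/negP => le.
have n0 : 0 < len g by case: (len g) (@len_eq0 g) => // /(_ erefl).
pose x0 : letter := (true, true); pose i := (len g).-1./2.
(* [i] is the middle position, or the left one of the two. *)
have ilt : i < gromov g^-1 g by rewrite /i; lia.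
have := lcp_nth x0 ilt.
rewrite nfV /word_inv nth_rev ?size_map; last by rewrite /i -/(len g); lia.
rewrite (nth_map x0); last by rewrite -/(len g); lia.
rewrite -/(len g).
have := nf_reduced g; rewrite /reduced => /(sortedP x0).
move=> red.
have [->|E] : len g - i.+1 = i \/ len g - i.+1 = i.+1 by rewrite /i; lia.
  by move/eqP; rewrite eq_sym (negPf (letter_inv_neq _)).
have := red i; rewrite -/(len g) E => /(_ _)/eqP h1 h2.
by apply: h1; [rewrite /i; lia | rewrite -h2 letter_invK].
Qed.
End Length.

(** * Nielsen reduction *)
Section Generates.
Variables (G : groupType).
Implicit Types x y g h : G.

Lemma generates_sub x y x' y' :
  (forall Q : G -> Prop, Q 1 -> (forall g h, Q g -> Q h -> Q (g / h)) ->
    Q x' -> Q y' -> Q x /\ Q y) ->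
  generates x y -> generates x' y'.
Proof.
move=> sub gen Q Q1 QF Qx' Qy'.
by have [Qx Qy] := sub Q Q1 QF Qx' Qy'; apply: gen.
Qed.

Lemma generates_conj x y h : generates x y -> generates (x ^ h) (y ^ h).
Proof.
move=> gen Q Q1 QF Qx Qy g; rewrite -(conjgKV h g).
apply: (gen (fun g => Q (g ^ h))) => // [|k l]; first by rewrite conj1g.
by rewrite conjMg conjVg; exact: QF.
Qed.

Lemma generates_commute x y :
  generates x y -> commute x y -> forall g h, commute g h.
Proof.
have closed k g h : commute k g -> commute k h -> commute k (g / h).
  by move=> kg kh; apply: commuteM => //; exact: commuteV.
move=> gen xy; have central k : k = x \/ k = y -> forall g, commute k g.
  move=> kxy; apply: gen; [exact: commute1 | exact: closed | |].
    by case: kxy => ->; [exact: commute_refl | exact: commute_sym].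
  by case: kxy => ->; [|exact: commute_refl].
move=> g; apply: gen; [exact: commute1 | exact: closed | |];
  by apply/commute_sym/central; auto.
Qed.

End Generates.

Section Nielsen.
Variables (F : groupType) (a b : F).
Hypothesis free : free_on2 a b.

Local Notation len := (len free).
Local Notation gromov := (gromov free).

Lemma free_noncommutative : ~ commute a b.
Proof.
move=> ab.
have := @word_eval_free_inj _ _ _ free [:: (true, true); (false, true)]
  [:: (false, true); (true, true)] erefl erefl.
by rewrite /= !mulg1 /letter_eval /= => /(_ ab).
Qed.

(** Here [(x, y)] cannot be shortened by an elementary move followed by a
simultaneous conjugation.  The conjugations are what disposes of ties: without
them a generator could cancel by halves against both of its neighbours, and a
secondary order on words would be needed to exclude this. *)
Section Reduced.
Variables x y : F.
Local Notation L := (letter_eval x y).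
Implicit Types l k m : letter.
Hypothesis gen : generates x y.
Hypothesis minimal : forall (l k : letter) h, l.1 != k.1 ->
  len x + len y <= len (L l ^ h) + len ((L l * L k) ^ h).

(** The number of letters over [a] and [b] that cancel on each side in
[L l * L k]. *)
Definition cancel l k := gromov (L l)^-1 (L k).

Lemma len_cancel l g :
  len (L l * g) + (gromov (L l)^-1 g).*2 = len (L l) + len g.
Proof. by rewrite -(lenV free (L l)) -len_gromov invgK. Qed.

Lemma len_letter_eval l : len (L l) = if l.1 then len x else len y.
Proof. by case: l => [[] []]; rewrite /letter_eval /= ?lenV. Qed.

Lemma letter_eval_neq1 l : L l <> 1.
Proof.
move=> l1; apply: free_noncommutative; apply: (generates_commute gen).
have [->|->] : x = 1 \/ y = 1.
  case: l l1 => [[] []]; rewrite /letter_eval /=; auto;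
    by move=> /(congr1 (fun g => g^-1)); rewrite invgK invg1; auto.
  exact/commute_sym/commute1.
exact: commute1.
Qed.

Lemma cancel_half l k : l.1 != k.1 ->
  (cancel l k).*2 <= len (L l) /\ (cancel l k).*2 <= len (L k).
Proof.
move=> lk; have lenlk : len (L l) + len (L k) = len x + len y.
  rewrite !len_letter_eval.
  by case: (l.1) (k.1) lk => [] [] // _; rewrite addnC.
have lek : len x + len y <= len (L l) + len (L l * L k).
  by have := minimal 1 lk; rewrite !conjg1.
have lel : len x + len y <= len (L k) + len (L l * L k).
  have := @minimal (letter_inv k) (letter_inv l) 1; rewrite eq_sym => /(_ lk).
  by rewrite !conjg1 !letter_evalV lenVV lenV.
by have := len_cancel l (L k); rewrite -/(cancel l k); lia.
Qed.

Lemma cancel_self l : (cancel l l).*2 < len (L l).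
Proof. by apply: gromov_inv_lt; exact: letter_eval_neq1. Qed.

Lemma letter_cases (l k : letter) : k != letter_inv l -> k = l \/ l.1 != k.1.
Proof. by case: l k => [[] []] [[] []]; auto. Qed.

(** If [v = L l] is consumed by halves in the product [u * v * u] with [u = L k],
then [v = p * q^-1] where [u] starts with [q] and ends with [p^-1].  Conjugating
[(v, v * u)] by [p] gives [(q^-1 * p, q^-1 * u * p)], which is shorter than
[(v, u)]. *)
Lemma cancel_tie l k n : l.1 != k.1 -> len (L l) = n.*2 ->
  cancel k l = n -> cancel l k = n -> False.
Proof.
move=> lk lenl ckl clk; set v := L l in lenl; set u := L k.
have n0 : 0 < n.
  by have := cancel_self l; rewrite lenl; lia.
have [p lenp lenpv] := @len_prefix _ _ _ free v n ltac:(lia).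
pose q := v^-1 * p; pose r := q^-1 * u.
have lenq : len q = n.
  by rewrite -lenV /q invgM invgK lenpv; lia.
have pv : gromov v p = n.
  by rewrite gromovC; have := len_gromov free p v; lia.
have qv : gromov q v^-1 = n.
  have := len_gromov free q v^-1.
  rewrite (_ : _ * _ = p^-1); last by rewrite /q; group.
  by rewrite !lenV; lia.
have qu : n <= gromov q u.
  have := gromov_ultrametric free q v^-1 u.
  by rewrite qv (_ : gromov v^-1 u = n) // minnn.
have lenr : len r + (gromov q u).*2 = n + len u.
  by rewrite -lenq -len_gromov.
have ru : len r + len u = n + (gromov r^-1 u^-1).*2.
  have := len_gromov free r^-1 u^-1.
  rewrite (_ : _ * _ = q^-1); last by rewrite /r; group.
  by rewrite !lenV; lia.
have up : n <= gromov u^-1 p.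
  have := gromov_ultrametric free u^-1 v p.
  by rewrite pv (_ : gromov u^-1 v = n) // minnn.
(* As [u] has length at least [n.*2], the elements [r^-1] and [u^-1] share a
   prefix, hence so do [r^-1] and [p]: conjugation by [p] shortens [v * u]. *)
have rp := gromov_ultrametric free r^-1 u^-1 p.
have lenrp : len (r * p) + (gromov r^-1 p).*2 = len r + n.
  by have := len_gromov free r^-1 p; rewrite invgK lenV lenp.
have lenqp : len (q^-1 * p) <= n + n.
  by have := len_gromov free q p; lia.
have lenvu : len v + len u = len x + len y.
  rewrite /v /u !len_letter_eval.
  by case: (l.1) (k.1) lk => [] [] // _; rewrite addnC.
have le : len x + len y <= len (q^-1 * p) + len (r * p).
  have -> : q^-1 * p = L l ^ p by rewrite /q /v; group.
  have -> : r * p = (L l * L k) ^ p by rewrite /r /q /u /v; group.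
  exact: minimal.
have [_] := cancel_half lk; rewrite clk -/u.
lia.
Qed.

(** No letter of a reduced word is consumed entirely by its two neighbours.  By
[cancel_half] the only danger is a tie, with both neighbours the same generator.
If they are inverse to each other, the tree inequality makes [L l] cancel half of
itself, against [cancel_self]; otherwise [cancel_tie] applies. *)
Lemma cancel_sum k l m : l != letter_inv k -> m != letter_inv l ->
  cancel k l + cancel l m < len (L l).
Proof.
move=> kl lm.
have ckl : (cancel k l).*2 <= len (L l).
  case: (letter_cases kl) => [->|/cancel_half[]//].
  exact/ltnW/cancel_self.
have clm : (cancel l m).*2 <= len (L l).
  case: (letter_cases lm) => [->|/cancel_half[]//].
  exact/ltnW/cancel_self.
case: (letter_cases kl) ckl => [lk|kl1] ckl.
  by move: ckl (cancel_self k); rewrite lk in clm *; lia.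
case: (letter_cases lm) clm => [->|lm1] clm.
  by have := cancel_self l; lia.
rewrite ltnNge; apply/negP => tie.
have [n [lenl c1 c2]] :
    exists n, [/\ len (L l) = n.*2, cancel k l = n & cancel l m = n].
  by exists (cancel k l); split; lia.
have [km|km] := eqVneq k m.
  by apply: (cancel_tie lm1 lenl _ c2); rewrite -km.
have km' : k = letter_inv m.
  by case: k l m kl1 lm1 km {kl lm ckl clm tie lenl c1 c2}
    => [[] []] [[] []] [[] []].
have := gromov_ultrametric free (L l)^-1 (L m) (L l).
have := cancel_self l.
move: c1 c2; rewrite /cancel km' letter_evalV invgK; lia.
Qed.

(** By [cancel_sum] a part of [L l] survives in the product, so that a letter
placed in front of the word only sees [L l]; each letter of the word then
contributes at least 1 to the length. *)
Lemma len_word l u : reduced (l :: u) ->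
  (forall k, l != letter_inv k ->
    gromov (L k)^-1 (word_eval x y (l :: u)) = cancel k l) /\
  (forall k, l != letter_inv k ->
    size (l :: u) + cancel k l <= len (word_eval x y (l :: u))).
Proof.
elim: u l => [|m u IHu] l red.
  split=> k kl /=; rewrite mulg1 //.
  have := cancel_sum kl (letter_inv_neq l); lia.
have /andP[/= ml redu] := red; have [grom size_le] := IHu m redu.
set g := word_eval x y (m :: u) in grom size_le *.
rewrite /= -[L m * word_eval x y u]/g.
have lenlg : len (L l * g) + (cancel l m).*2 = len (L l) + len g.
  by rewrite -(grom l ml); exact: len_cancel.
have /= sizeg := size_le l ml.
split=> k kl; have csum := cancel_sum kl ml; last by lia.
have glg : len g + (gromov (L l) (L l * g)).*2 = len (L l) + len (L l * g).
  by rewrite -len_gromov mulKg.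
have := gromov_ultrametric free (L k)^-1 (L l) (L l * g).
have := gromov_ultrametric free (L k)^-1 (L l * g) (L l).
rewrite (gromovC free (L l * g)) -/(cancel k l).
lia.
Qed.

Lemma size_le_len u : reduced u -> size u <= len (word_eval x y u).
Proof.
case: u => // l u red; have [_ /(_ l (letter_inv_neq l))] := len_word red; lia.
Qed.

End Reduced.

(** A pair of minimal length, up to moves and conjugation, consists of [a] and [b]
up to order and inversion: [a] has length 1, so by [size_le_len] it is a word of
one letter over the pair, and so is [b].  The hypotheses on [Q] are stated for the
reversed moves since the induction goes down from an arbitrary pair. *)
Lemma nielsen_induction (Q : F -> F -> Prop) :
  Q a b ->
  (forall x y, Q y x -> Q x y) ->
  (forall x y, Q x^-1 y -> Q x y) ->
  (forall x y, Q (y * x) y -> Q x y) ->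
  (forall x y h, Q (x ^ h) (y ^ h) -> Q x y) ->
  forall x y, generates x y -> Q x y.
Proof.
move=> Qab Qswap Qinv Qmul Qconj.
have Qletters x y (l k : letter) : l.1 != k.1 ->
    Q (letter_eval x y l) (letter_eval x y k) -> Q x y.
  by case: l k => [[] []] [[] []] //= _; rewrite /letter_eval /=; auto.
have gen_letters x y (l k : letter) (h : F) : l.1 != k.1 -> generates x y ->
    generates (letter_eval x y l ^ h)
      ((letter_eval x y l * letter_eval x y k) ^ h).
  move=> lk gen; apply: generates_conj; apply: generates_sub gen => P P1 PF.
  have PV g : P g -> P g^-1 by move=> Pg; rewrite -[g^-1]mul1g; exact: PF.
  have PVK g : P g^-1 -> P g by move=> /PV; rewrite invgK.
  move=> Pl Plk; have Pk : P (letter_eval x y k).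
    have := PF _ _ (PV _ Pl) (PV _ Plk).
    by rewrite invgK mulKg.
  by case: l k lk Pl Pk {Plk} => [[] []] [[] []] //= _;
    rewrite /letter_eval /=; auto.
move=> x y; have [n] := ubnP (len x + len y).
elim: n x y => // n IHn x y lt_n gen.
apply: contrapT => nQ.
have minimal (l k : letter) h : l.1 != k.1 ->
    len x + len y <= len (letter_eval x y l ^ h) +
      len ((letter_eval x y l * letter_eval x y k) ^ h).
  move=> lk; rewrite leqNgt; apply/negP => lt; apply: nQ.
  apply: (Qletters _ _ _ _ lk); apply/Qswap/Qmul/Qswap; apply: (Qconj _ _ h).
  by apply: IHn; [lia | exact: gen_letters].
have letter_of z : exists l, letter_eval x y l = letter_eval a b (z, true).
  have [u red eu] := generates_word gen (letter_eval a b (z, true)).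
  have := size_le_len gen minimal red; rewrite eu.
  have -> : len (letter_eval a b (z, true)) = 1%N.
    rewrite -[letter_eval _ _ _]mulg1 -[_ * 1]/(word_eval a b [:: (z, true)]).
    by rewrite /len nf_word_eval.
  case: u red eu => [|l [|? ?]] // _ eu _; last first.
    by exists l; rewrite -eu /= mulg1.
  have := @word_eval_free_inj _ _ _ free [:: (z, true)] [::] erefl erefl.
  by rewrite /= -eu mulg1 => /(_ erefl).
have [[l al] [k bk]] := (letter_of true, letter_of false).
apply/nQ/(Qletters _ _ l k); last by rewrite al bk.
apply/negP => /eqP lk.
have abV : a = b \/ a = b^-1.
  move: al bk; rewrite /letter_eval /=; case: l k lk => [z s] [z' s'] /= <-.
  case: (eqVneq s s') => [-> <- <-|]; first by left.
  by case: s s' z => [] [] [] //= _ <- <-; rewrite ?invgK; right.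
apply: free_noncommutative; case: abV => ->; first exact: commute_refl.
by apply/commute_sym/commuteV; exact: commute_refl.
Qed.

End Nielsen.

(** * Half planes and the braid action on bases *)
Section OrderLemmas.
Variables (G : groupType) (o : biorder G).
Implicit Types x y g h : G.

Lemma blt_conj g x y : o x y -> o (x ^ g) (y ^ g).
Proof. by move=> xy; rewrite !conjgE; apply/blt_mull/blt_mulr. Qed.

Lemma blt_conjE g x y : o (x ^ g) (y ^ g) <-> o x y.
Proof.
split; last exact: blt_conj.
by move=> /(blt_conj g^-1); rewrite !conjgK.
Qed.

Lemma blt_quotient x y : o 1 (x^-1 * y) <-> o x y.
Proof.
split=> [/(blt_mull x)|/(blt_mull x^-1)]; first by rewrite mulg1 mulVKg.
by rewrite mulVg.
Qed.

Lemma blt_asym x y : o x y -> o y x -> False.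
Proof. by move=> xy yx; apply: (@blt_irr _ o x); apply: blt_trans yx. Qed.

Lemma blt1V x : o 1 x -> o 1 x^-1 -> False.
Proof.
by move=> x1 /(blt_mull x); rewrite mulg1 mulgV; exact: blt_asym.
Qed.

End OrderLemmas.

Section Sectors.
Variables (G : groupType) (o : biorder G) (c : G).
Implicit Types x y u v g h : G.

(** The four half planes, in the order of rotation: [(false, true)] for [1 < g],
[(true, true)] for [c ^ g < c], then their inverses [(false, false)] and
[(true, false)]. *)
Definition sector := (bool * bool)%type.
Definition turn (k : sector) : sector := (~~ k.1, k.1 (+) k.2).
Definition opp (k : sector) : sector := (k.1, ~~ k.2).
Definition semicone (t : bool) (g : G) : Prop :=
  if t then o (c ^ g) c else o 1 g.
Definition in_sector (k : sector) (g : G) : Prop :=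
  semicone k.1 (if k.2 then g else g^-1).

Lemma semiconeM t g h : semicone t g -> semicone t h -> semicone t (g * h).
Proof.
case: t => /= cg ch.
  by rewrite conjgM; apply: blt_trans ch; exact: blt_conj.
by apply: blt_trans cg _; rewrite -{1}[g]mulg1; exact: blt_mull.
Qed.

Lemma semiconeV t g : semicone t g -> semicone t g^-1 -> False.
Proof.
case: t => /=; last exact: blt1V.
move=> cg /(blt_conj g); rewrite conjgKV; exact: blt_asym.
Qed.

Lemma in_sectorM k g h : in_sector k g -> in_sector k h -> in_sector k (g * h).
Proof.
rewrite /in_sector; case: k.2 => gk hk; first exact: semiconeM.
by rewrite invgM; exact: semiconeM.
Qed.

Lemma in_sectorV k g : in_sector k g^-1 <-> in_sector (opp k) g.
Proof. by rewrite /in_sector /opp /=; case: k.2; rewrite /= ?invgK. Qed.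

Lemma in_sectorN k g : in_sector k g -> in_sector (opp k) g -> False.
Proof.
rewrite /in_sector /opp /=.
by case: k.2 => /= gk gk'; [exact: semiconeV gk gk' | exact: semiconeV gk' gk].
Qed.

Lemma oppK : involutive opp.
Proof. by case=> t e; rewrite /opp /= negbK. Qed.

Lemma turn2 k : turn (turn k) = opp k.
Proof. by case: k => [[] []]. Qed.

(** Conjugation does not preserve the condition [c ^ g < c] in general; but when
[c] is the commutator of [x] and [y], conjugating [y] by [x] multiplies [y] by
[c^-1], which commutes with [c]. *)
Lemma in_sectorJ k x y : [~ x, y] = c -> in_sector k (y ^ x) <-> in_sector k y.
Proof.
move=> xyc; rewrite /in_sector /semicone; case: k => [[] []] /=.
- have -> : y ^ x = y * c^-1 by rewrite -xyc /commg; group.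
  have cc : c ^ c^-1 = c by group.
  by have := blt_conjE o c^-1 (c ^ y) c; rewrite -conjgM cc.
- have -> : (y ^ x)^-1 = c * y^-1 by rewrite -xyc /commg; group.
  by have -> : c ^ (c * y^-1) = c ^ y^-1 by group.
- by rewrite -{1}(conj1g x); exact: blt_conjE.
- by rewrite -{1}(conj1g x) -conjVg; exact: blt_conjE.
Qed.

(** For [k = (false, true)] these are the patterns [expanding] and [contracting]
with commutator [c]; the other values of [k] are their images under turns. *)
Definition expand_at k x y : Prop :=
  [/\ [~ x, y] = c, in_sector k x, in_sector (opp (turn k)) x, in_sector k y
    & in_sector (turn k) y].
Definition contract_at k x y : Prop :=
  [/\ in_sector k x, in_sector (turn k) x, in_sector k y
    & in_sector (opp (turn k)) y].

Lemma commg_turn x y : [~ y ^ x, x^-1] = [~ x, y].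
Proof. by rewrite /commg; group. Qed.

Lemma expand_at_turn k x y : expand_at k x y -> expand_at (turn k) (y ^ x) x^-1.
Proof.
move=> [xyc kx okx ky kky]; split.
- by rewrite commg_turn.
- exact/in_sectorJ.
- by rewrite turn2 oppK; exact/in_sectorJ.
- exact/in_sectorV.
- by rewrite turn2; apply/in_sectorV; rewrite oppK.
Qed.

Lemma expand_at_turnV k x y :
  expand_at k x y -> expand_at (opp (turn k)) y^-1 (x ^ y).
Proof.
move=> [xyc kx okx ky kky].
have yxc : [~ y^-1, x ^ y] = c by rewrite -xyc /commg; group.
have Jx l : in_sector l x -> in_sector l (x ^ y).
  by move=> lx; apply/(in_sectorJ _ yxc); rewrite -conjgM mulgV conjg1.
have toT : turn (opp (turn k)) = k by case: (k) => [[] []].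
split=> //.
- by apply/in_sectorV; rewrite oppK.
- by rewrite toT; apply/in_sectorV; rewrite oppK.
- exact: Jx.
- by rewrite toT; exact: Jx.
Qed.

Lemma contract_at_turn k x y : [~ x, y] = c ->
  contract_at k x y -> contract_at (opp (turn k)) (y ^ x) x^-1.
Proof.
have toT l : turn (opp (turn l)) = l by case: l => [[] []].
move=> xyc [kx kkx ky oky]; split; rewrite ?toT.
- exact/in_sectorJ.
- exact/in_sectorJ.
- by apply/in_sectorV; rewrite oppK.
- by apply/in_sectorV; rewrite oppK.
Qed.

Lemma contract_at_turnV k x y : [~ x, y] = c ->
  contract_at k (y ^ x) x^-1 -> contract_at (turn k) x y.
Proof.
move=> xyc [/(in_sectorJ k xyc) ky /(in_sectorJ _ xyc) kky].
move=> /in_sectorV kx /in_sectorV okx; split=> //.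
- by move: okx; rewrite oppK.
- by rewrite turn2.
- by rewrite turn2 oppK.
Qed.

(** Images of a basis under the monoid generated by the two positive moves. *)
Inductive positive_image (x y : G) : G -> G -> Prop :=
| positive_refl : positive_image x y x y
| positive_left u v : positive_image x y u v -> positive_image x y (v * u) v
| positive_right u v : positive_image x y u v -> positive_image x y u (u * v).

Lemma positive_image_sector k x y u v : positive_image x y u v ->
  in_sector k x -> in_sector k y -> in_sector k u /\ in_sector k v.
Proof.
move=> pos kx ky; elim: pos => [|? ? _ [? ?]|? ? _ [? ?]]; split=> //;
  exact: in_sectorM.
Qed.

Lemma positive_image_mixed k x y u v : positive_image x y u v ->
  in_sector k u -> in_sector (opp k) v -> in_sector k x /\ in_sector (opp k) y.
Proof.
elim=> [|{}u {}v _ IH ku kv|{}u {}v _ IH ku kv] //; apply: IH => //.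
  by rewrite -(mulKg v u); apply: in_sectorM => //; apply/in_sectorV.
rewrite -(mulKg u v); apply: in_sectorM => //.
by apply/in_sectorV; rewrite oppK.
Qed.

(** Say that [k] belongs to [(x, y)] and [l] to [(u, v)].  Both [u] and [v] are in
half plane [k] as [x] and [y] are, which excludes three values of [l].  If
[l = k], then [u] and [v] are on opposite sides of the half plane [turn k];
undoing positive moves keeps them so, but [x] and [y] are on opposite sides the
other way round. *)
Lemma positive_image_disjoint k l x y u v :
  expand_at k x y -> positive_image x y u v -> contract_at l u v -> False.
Proof.
move=> [_ kx okx ky kky] pos [lu llu lv olv].
have [ku kv] := positive_image_sector pos kx ky.
have : k = l \/ k = turn l \/ k = opp l \/ k = opp (turn l).
  by case: k l {lu llu lv olv kx okx ky kky ku kv} => [[] []] [[] []]; auto.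
case=> [kl|[kl|[kl|kl]]]; subst k.
- have [lx _] := positive_image_mixed pos llu olv.
  exact: in_sectorN lx okx.
- exact: in_sectorN kv olv.
- exact: in_sectorN lu ku.
- exact: in_sectorN llu ku.
Qed.

(** The orbit of the expanding bases with commutator [c], presented in the form of
a turn applied to a positive image.  The turns that come first are absorbed in the
index [k]. *)
Inductive braid_orbit : G -> G -> Prop :=
| braid_positive k x y u v :
    expand_at k x y -> positive_image x y u v -> braid_orbit u v
| braid_turn x y : braid_orbit x y -> braid_orbit (y ^ x) x^-1
| braid_turnV x y : braid_orbit (y ^ x) x^-1 -> braid_orbit x y.

Lemma braid_orbit_comm x y : braid_orbit x y -> [~ x, y] = c.
Proof.
elim=> [k {}x {}y u v [xyc _ _ _ _]|{}x {}y _|{}x {}y _]; last 2 first.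
- by rewrite commg_turn.
- by rewrite commg_turn.
by elim=> // {}u {}v _ <-; rewrite /commg; group.
Qed.

Lemma braid_orbit_disjoint x y : braid_orbit x y ->
  forall l, contract_at l x y -> False.
Proof.
elim=> [k {}x {}y u v exy pos l|{}x {}y orb IH l clxy|{}x {}y orb IH l clxy].
- exact: positive_image_disjoint exy pos.
- apply: (IH (turn l)); apply: contract_at_turnV clxy.
  exact: braid_orbit_comm.
- apply: (IH (opp (turn l))); apply: contract_at_turn clxy.
  by rewrite -commg_turn; exact: braid_orbit_comm.
Qed.

Lemma braid_orbit_eq x y x' y' :
  braid_orbit x y -> x' = x -> y' = y -> braid_orbit x' y'.
Proof. by move=> + -> ->. Qed.

(** Write L and R for the moves to [(y * x, y)] and [(x, x * y)], and S for the
turn.  As maps on pairs they satisfy L S = S R^-1 and R S = S L^-1, which carry a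
move through turns, and L^-1 R = S^-1 L and R^-1 L = S R, which remove an inverse
move in front of a positive word.  On the empty word, L^-1 = S^-1 R S and
R^-1 = S L S^-1. *)
Lemma braid_orbit_moves x y : braid_orbit x y ->
  [/\ braid_orbit (y * x) y, braid_orbit (y^-1 * x) y,
      braid_orbit x (x * y) & braid_orbit x (x^-1 * y)].
Proof.
elim=> [k {}x {}y u v exy pos|{}x {}y _ [L LV R RV]|{}x {}y _ [L LV R RV]].
- have positive := braid_positive exy.
  split; [exact/positive/positive_left| |exact/positive/positive_right|].
  + case: pos => [|{}u {}v pos|{}u {}v pos].
    * apply: braid_turnV.
      have orb := braid_positive (expand_at_turn exy)
        (positive_right (positive_refl (y ^ x) x^-1)).
      by apply: (braid_orbit_eq orb); group.
    * by rewrite mulKg; exact: positive.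
    * apply: braid_turnV.
      by apply: (braid_orbit_eq (positive _ _ (positive_left pos))); group.
  + case: pos => [|{}u {}v pos|{}u {}v pos].
    * have orb := braid_positive (expand_at_turnV exy)
        (positive_left (positive_refl y^-1 (x ^ y))).
      by apply: (braid_orbit_eq (braid_turn orb)); group.
    * have orb := positive _ _ (positive_right pos).
      by apply: (braid_orbit_eq (braid_turn orb)); group.
    * by rewrite mulKg; exact: positive.
- split.
  + by apply: (braid_orbit_eq (braid_turn RV)); group.
  + by apply: (braid_orbit_eq (braid_turn R)); group.
  + by apply: (braid_orbit_eq (braid_turn LV)); group.
  + by apply: (braid_orbit_eq (braid_turn L)); group.
- split; apply: braid_turnV.
  + by apply: (braid_orbit_eq RV); group.
  + by apply: (braid_orbit_eq R); group.
  + by apply: (braid_orbit_eq LV); group.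
  + by apply: (braid_orbit_eq L); group.
Qed.

End Sectors.

(** * No orbit meets both patterns *)
Section Incompatibility.
Variables (F : groupType) (a b : F).
Hypothesis free : free_on2 a b.

Lemma contracting_conj (o : biorder F) x y h :
  contracting o x y -> contracting o (x ^ h) (y ^ h).
Proof.
have conj1 z : o 1 z -> o 1 (z ^ h).
  by move=> z1; rewrite -(conj1g h); exact: blt_conj.
rewrite /contracting -conjRg -!conjJg => -[*].
by split; [exact: conj1 | exact: conj1 | exact: conj1 | |]; exact: blt_conj.
Qed.

(** Up to simultaneous conjugation and exchange of its two members, every basis is
in the braid orbit of [(a, b)].  In the orbit it is not contracting; and after an
exchange its commutator is conjugate to the inverse of [c], hence negative. *)
Lemma expanding_contracting_disjoint (o : biorder F) x y :
  expanding o a b -> generates x y -> contracting o x y -> False.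
Proof.
set c := [~ a, b] => -[a1 b1 c1 ca cb].
have start : expand_at o c (false, true) a b.
  split=> //; rewrite /in_sector /= -/c.
  by apply/(blt_conjE o a); rewrite conjgKV.
pose orbit := braid_orbit o c.
pose Q x y := exists h, orbit (x ^ h) (y ^ h) \/ orbit (y ^ h) (x ^ h).
have Q_of x' y' h :
    orbit (x' ^ h) (y' ^ h) \/ orbit (y' ^ h) (x' ^ h) -> Q x' y'.
  by exists h.
move=> gen; have [] : Q x y.
  apply: (nielsen_induction free (Q := Q)) gen => {x y}.
  - exists 1; left; rewrite !conjg1.
    exact: braid_positive start (positive_refl _ _).
  - by move=> x y [h orb]; exists h; case: orb; auto.
  - move=> x y [h [orb|orb]].
      apply: (Q_of _ _ (x^-1 * h)); right.
      by apply: (braid_orbit_eq (braid_turn orb)); group.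
    apply: (Q_of _ _ (x^-1 * h)); left; apply: braid_turnV.
    by apply: (braid_orbit_eq orb); group.
  - move=> x y [h [orb|orb]].
      exists h; left; have [_ L _ _] := braid_orbit_moves orb.
      by apply: (braid_orbit_eq L); group.
    exists h; right; have [_ _ _ R] := braid_orbit_moves orb.
    by apply: (braid_orbit_eq R); group.
  - by move=> x y k [h orb]; exists (k * h); rewrite !conjgM.
move=> h orb /(contracting_conj h) [x1 y1 xy1 cx cy].
case: orb => orb; have xyc := braid_orbit_comm orb.
  apply: (braid_orbit_disjoint orb (l := (false, true))).
  rewrite xyc in cx cy; split=> //; rewrite /in_sector /=.
  by apply/(blt_conjE o (y ^ h)); rewrite conjgKV.
apply: (blt1V c1); rewrite -/c -xyc.
by have -> : [~ y ^ h, x ^ h]^-1 = [~ x ^ h, y ^ h] by rewrite invgR.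
Qed.

End Incompatibility.

Section Openness.
Local Open Scope classical_set_scope.
Variables (G : groupType) (x y : G).

Lemma blt_open g h : open [set o : biorder G | o g h].
Proof.
exists [set [set g^-1 * h]]; first by move=> _ ->; exact: finite_set1.
rewrite bigcup_set1; apply/seteqP; split=> o /=.
  by move=> ogh; apply/blt_quotient; exact: ogh.
by move=> /blt_quotient ogh _ ->.
Qed.

Lemma expanding_open : open [set o : biorder G | expanding o x y].
Proof.
have := openI (blt_open 1 x) (openI (blt_open 1 y) (openI (blt_open 1 [~ x, y])
  (openI (blt_open [~ x, y] ([~ x, y] ^ x))
         (blt_open ([~ x, y] ^ y) [~ x, y])))).
congr open; apply/seteqP; split=> o /=; first by case=> ? [? [? []]].
by case.
Qed.

Lemma contracting_open : open [set o : biorder G | contracting o x y].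
Proof.
have := openI (blt_open 1 x) (openI (blt_open 1 y) (openI (blt_open 1 [~ x, y])
  (openI (blt_open ([~ x, y] ^ x) [~ x, y])
         (blt_open [~ x, y] ([~ x, y] ^ y))))).
congr open; apply/seteqP; split=> o /=; first by case=> ? [? [? []]].
by case.
Qed.
End Openness.

Section ActionOnPairs.
Variables (G : groupType) (s : aut G) (o : biorder G) (x y : G).

Lemma blt_actE g h : act s o (s g) (s h) <-> o g h.
Proof. exact: act_ltE. Qed.

Lemma act1 g : act s o 1 (s g) <-> o 1 g.
Proof. by rewrite -blt_actE gmulf1. Qed.

Lemma act_contracting : contracting (act s o) (s x) (s y) <-> contracting o x y.
Proof.
rewrite /contracting -gmulfR -!gmulfJ; split=> -[? ? ? ? ?];
  by split; [exact/act1 | exact/act1 | exact/act1 | exact/blt_actE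
    | exact/blt_actE].
Qed.
End ActionOnPairs.

Theorem theorem3 (F2 : groupType) (a b : F2) (hF2 : @free_on2 F2 a b) :
  ~ exists o : biorder F2, dense (orbit_of o).
Proof.
case=> o o_dense.
have [o1 [exp [s _ es]]] :=
  o_dense _ (free_expanding hF2) (expanding_open a b).
have [o2 [con [t _ et]]] :=
  o_dense _ (free_contracting hF2) (contracting_open a b).
rewrite /= -{o1}es in exp; rewrite /= -{o2}et in con.
have [[x aE] [y bE]] := (aut_surj t a, aut_surj t b).
move: con; rewrite aE bE => /act_contracting/(act_contracting s) con.
apply: (expanding_contracting_disjoint hF2 exp _ con).
apply/(generates_surj _ _ (aut_bij s))/(generates_surj _ _ (aut_bij t)).
by rewrite -aE -bE; exact: free_on2_generates.
Qed.
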